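(* Let $p$ be a prime, $m,n\ge 2$ integers and $a,b,c,d,e,f,g,h\in\mathbb{Z}_p$. Let $T_{\mathrm R}^{\phi}\in\mathbf{M}_{mn\times mn}(\mathbb{Z}_p)$ be the $m\times m$ block matrix $$T_{\mathrm R}^{\phi}=\begin{pmatrix} A_1 & B_1 & O & O &\dots & O & O & O\\ C_1 & A_1 & B_1 & O & \dots & O & O & O\\ O & C_1 & A_1 & B_1 &\dots & O & O & O\\ \vdots & \vdots & \vdots & \vdots &\ddots &\vdots & \vdots & \vdots\\ O & O & O & O & \dots & C_1 & A_1 & B_1\\ O & O & O & O & \dots & O & D_1 & A_1 \end{pmatrix}$$ with $n\times n$ blocks $A_1,B_1,C_1,D_1$ defined in the context. If $B_1$ has full rank, then $$\operatorname{rank}(T_{\mathrm R}^{\phi})=(m-1)n+\operatorname{rank}(P_m),$$ where the $n\times n$ matrices $P_1,\dots,P_m$ are defined by $P_1=A_1$, $P_2=D_1-A_1B_1^{-1}A_1$, and $P_k=-P_{k-2}B_1^{-1}C_1-P_{k-1}B_1^{-1}A_1$ for $3\le k\le m$.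
   Context: $T_{\mathrm R}^{\phi}$ is the rule matrix of the two-dimensional linear Moore cellular automaton on an $m\times n$ grid over $\mathbb{Z}_p$ with null boundary on top and left and reflexive boundary on bottom and right; only its explicit block form is needed for the statement. Blocks are $n\times n$ over $\mathbb{Z}_p$. Let $P$ have ones on the first superdiagonal and zeros elsewhere, $Q=P^T$, $I$ the identity, $O$ the zero matrix, and $\epsilon_{k,l}$ the matrix unit with a single $1$ in position $(k,l)$. Put $A=dP+hQ$, $B=fI+eP+gQ$, $C=bI+cP+aQ$, and $A_1=A+d\,\epsilon_{n,n-1}$, $B_1=B+e\,\epsilon_{n,n-1}$, $C_1=C+c\,\epsilon_{n,n-1}$, $D_1=B+C+(c+e)\,\epsilon_{n,n-1}+g\,\epsilon_{1,2}$. All diagonal blocks of $T_{\mathrm R}^{\phi}$ are $A_1$, all superdiagonal blocks are $B_1$, and all subdiagonal blocks are $C_1$ except the last one, in block position $(m,m-1)$, which is $D_1$; all other blocks are $O$. Ranks are over the field $\mathbb{Z}_p$. *)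

(* Defs.v *)
From HB Require Import structures.
From mathcomp Require Import all_boot all_order all_algebra.
Set Implicit Arguments.
Unset Strict Implicit.
Unset Printing Implicit Defensive.
Import GRing.Theory.
Local Open Scope ring_scope.

(* The matrix unit with its 1 in position (k, l), where k and l count from 1. *)
Definition epsmx (F : fieldType) (n k l : nat) : 'M[F]_n :=
  \matrix_(i, j) ((i.+1 == k) && (j.+1 == l))%:R.

Definition Pmx (F : fieldType) (n : nat) : 'M[F]_n :=
  \matrix_(i, j) (j == i.+1 :> nat)%:R.

Definition Qmx (F : fieldType) (n : nat) : 'M[F]_n := (Pmx F n)^T.

Definition Amx (F : fieldType) (n : nat) (d h : F) : 'M[F]_n :=
  d *: Pmx F n + h *: Qmx F n.

Definition Bmx (F : fieldType) (n : nat) (e f g : F) : 'M[F]_n :=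
  f *: 1%:M + e *: Pmx F n + g *: Qmx F n.

Definition Cmx (F : fieldType) (n : nat) (a b c : F) : 'M[F]_n :=
  b *: 1%:M + c *: Pmx F n + a *: Qmx F n.

Definition A1mx (F : fieldType) (n : nat) (d h : F) : 'M[F]_n :=
  Amx n d h + d *: epsmx F n n n.-1.

Definition B1mx (F : fieldType) (n : nat) (e f g : F) : 'M[F]_n :=
  Bmx n e f g + e *: epsmx F n n n.-1.

Definition C1mx (F : fieldType) (n : nat) (a b c : F) : 'M[F]_n :=
  Cmx n a b c + c *: epsmx F n n n.-1.

Definition D1mx (F : fieldType) (n : nat) (a b c e f g : F) : 'M[F]_n :=
  Bmx n e f g + Cmx n a b c + (c + e) *: epsmx F n n n.-1
  + g *: epsmx F n 1 2.

(* The (i, j) block, with i and j counting from 0. *)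
Definition ruleblock (F : fieldType) (m n : nat) (A1 B1 C1 D1 : 'M[F]_n)
    (i j : nat) : 'M[F]_n :=
  if i == j then A1
  else if j == i.+1 then B1
  else if i == j.+1 then (if i.+1 == m then D1 else C1)
  else 0.

(* The dimension \sum_(i < m) n is the form of m * n produced by \mxblock. *)
Definition TRphi (F : fieldType) (m n : nat) (a b c d e f g h : F) :
    'M[F]_(\sum_(i < m) n) :=
  \mxblock_(i < m, j < m)
    ruleblock m (A1mx n d h) (B1mx n e f g) (C1mx n a b c)
      (D1mx n a b c e f g) i j.

(* Indices count from 1; the value at 0 is never used. *)
Fixpoint Pseq (F : fieldType) (n : nat) (A1 B1 C1 D1 : 'M[F]_n) (k : nat) :
    'M[F]_n :=
  match k with
  | 0 => 0
  | 1 => A1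
  | 2 => D1 - A1 *m invmx B1 *m A1
  | (k2.+1 as k1).+1 =>
      - (Pseq A1 B1 C1 D1 k2 *m invmx B1 *m C1)
      - Pseq A1 B1 C1 D1 k1 *m invmx B1 *m A1
  end.

(* Main.v *)
Require Import Defs.
From HB Require Import structures.
From mathcomp Require Import all_boot all_order all_algebra.
Import GRing.Theory.
Local Open Scope ring_scope.

(** Block Gaussian elimination from the right. Since the superdiagonal blocks
    [B] are invertible, the nonzero blocks of the last block row can be moved
    one column to the left at a time: if that row currently ends with [P_k],
    subtracting [P_k B^-1] times the block row whose last block stands in the
    same column replaces it by a row ending with [P_(k+1)], which is exactly
    the recursion defining [Pseq]. After [m - 1] steps only [P_m] is left, in
    the first column.

    All these row operations are gathered into one factorization
    [K *m T = D *m L] ([elim_mul_tridiag]). The first block row of [K] carries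
    the elimination coefficients and its other rows move the first [m - 1]
    block rows of [T] down by one. The result is block lower triangular with
    diagonal [P_m, B, ..., B]. The block [P_m] is alone in its row, so it can
    be factored out on the left as [D = diag (P_m, I, ..., I)], which leaves an
    [L] with diagonal [I, B, ..., B]. Both [K] and [L] have invertible pivots
    ([unitmx_pivots]), hence [T] has the rank of [D], which is
    [(m - 1) n + rank P_m]. *)

(** Block forward substitution: in [M *m x = 0] the block row [s i] has an
    invertible coefficient at [x_i] and involves no later unknown. Letting the
    pivot rows be chosen by [s] covers matrices that are block triangular only
    after a permutation of their rows. *)
Lemma unitmx_pivots (F : fieldType) (m n : nat) (M : nat -> nat -> 'M[F]_n)
    (s : 'I_m -> 'I_m) :
  (forall i : 'I_m, M (s i) i \in unitmx) ->
  (forall i j : 'I_m, (i < j)%N -> M (s i) j = 0) ->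
  \mxblock_(i < m, j < m) M i j \in unitmx.
Proof.
move=> Mpivot Mright; set N := \mxblock_(i, j) _.
suff N0: cokermx N = 0.
  rewrite -row_full_unit /row_full eqn_leq rank_leq_col /=.
  by rewrite -subn_eq0 -mxrank_coker N0 mxrank0.
pose X i := submxcol (cokermx N) i.
have NX0 (i : 'I_m) : \sum_(j < m) M i j *m X j = 0.
  have := mulmx_coker N.
  rewrite -[cokermx N]submxcolK mul_mxblock_mxrow -/X => NX.
  have := congr1 (fun Y => submxcol Y i) NX.
  by rewrite mxcolK submxcol0.
have X0 k : forall i : 'I_m, (i < k)%N -> X i = 0.
  elim: k => // k IHk i; rewrite ltnS => le_ik.
  have := NX0 (s i).
  rewrite [X in X = _](bigD1 i) //= [X in _ + X]big1 ?addr0 => [MX0|j neq_ji].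
    by rewrite -[X i](mulKmx (Mpivot i)) MX0 mulmx0.
  have [lt_ij|lt_ji|eq_ij] := ltngtP i j.
  - by rewrite Mright // mul0mx.
  - by rewrite IHk ?mulmx0 // (leq_trans lt_ji).
  - by rewrite (val_inj eq_ij) eqxx in neq_ji.
apply/mxcolP => i; rewrite submxcol0; exact: X0 (ltnSn i).
Qed.

Lemma sum_ruleblock (F : fieldType) (m n : nat) (A B C D : 'M[F]_n)
    (X : nat -> 'M[F]_n) (j : nat) :
  (j < m)%N ->
  \sum_(k < m) X k *m ruleblock m A B C D k j =
    (if (0 < j)%N then X j.-1 *m B else 0) + X j *m A
    + (if (j.+1 < m)%N
       then X j.+1 *m (if j.+2 == m then D else C) else 0).
Proof.
move=> lt_jm.
rewrite (eq_bigr (fun k : 'I_m =>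
    (if ((0 < j) && (k == j.-1 :> nat))%N then X k *m B else 0)
    + (if (k == j :> nat)%N then X k *m A else 0)
    + (if (k == j.+1 :> nat)%N
       then X k *m (if k.+1 == m :> nat then D else C) else 0))).
  rewrite !big_split /= -!big_mkcond /=; congr (_ + _ + _).
  - case: j lt_jm => [|j] lt_jm /=; first by rewrite big_pred0_eq.
    by rewrite (big_ord1_eq _ (fun k => X k *m B)) (ltnW lt_jm).
  - by rewrite (big_ord1_eq _ (fun k => X k *m A)) lt_jm.
  - by rewrite (big_ord1_eq _
      (fun k => X k *m (if k.+1 == m :> nat then D else C))).
move=> k _; rewrite /ruleblock.
have [->|neq_kj] := eqVneq (k : nat) j.
  have -> : (j == j.+1) = false by rewrite ltn_eqF.
  have -> : ((0 < j) && (j == j.-1))%N = false.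
    by case: (j) => //= i; rewrite gtn_eqF.
  by rewrite add0r addr0.
have -> : ((0 < j) && (k == j.-1 :> nat))%N = (j == k.+1).
  by case: (j) => //= i; rewrite eqSS eq_sym.
case: eqP => [->|_].
  have -> : (k == k.+2 :> nat) = false by rewrite ltn_eqF // ltnW.
  by rewrite !addr0.
by case: ifP => _; rewrite ?mulmx0 !add0r.
Qed.

Section Elimination.

Variables (F : fieldType) (m n : nat) (A B C D : 'M[F]_n).
Hypothesis unitB : B \in unitmx.

Local Notation P := (Pseq A B C D).

(** There are [m + 1] block rows, counted from 0: block row [k] is [m - k]
    steps above the last one, so its block [B] has to cancel [P_(m-k)]. The
    last block row itself keeps the coefficient [I], which is not the value of
    the general formula because [P_0 = 0]. *)
Definition elim_coef (k : nat) : 'M[F]_n :=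
  if k == m then 1%:M else - (P (m - k) *m invmx B).

Definition elim_block (i k : nat) : 'M[F]_n :=
  if i is i'.+1 then (k == i')%:R%:M else elim_coef k.

Definition lower_block (i j : nat) : 'M[F]_n :=
  if i is i'.+1 then ruleblock m.+1 A B C D i' j else (j == 0%N)%:R%:M.

Definition diag_block (i : nat) : 'M[F]_n :=
  if i is _.+1 then 1%:M else P m.+1.

(** The sum over [k] telescopes: the contributions of [A] and of the
    subdiagonal block to column [j] add up to [P_(m+1-j)] by the recursion for
    [Pseq], and the multiplier of [B] is chosen to cancel it when [j > 0]. *)
Lemma sum_elim_coef_ruleblock (j : nat) : (j < m.+1)%N ->
  \sum_(k < m.+1) elim_coef k *m ruleblock m.+1 A B C D k j =
  if j == 0%N then P m.+1 else 0.
Proof.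
move=> lt_jm; rewrite sum_ruleblock // -addrA.
set R := (_ *m A + _).
have -> : R = P (m.+1 - j).
  rewrite {}/R /elim_coef ltnS eqSS.
  move: lt_jm; rewrite ltnS leq_eqVlt => /orP[/eqP->|lt_jm].
    by rewrite eqxx ltnn mul1mx addr0 subSnn.
  rewrite lt_jm (ltn_eqF lt_jm); case: eqP => [<-|/eqP neq_j1m].
    by rewrite mul1mx subSnn subSn // subSnn /= mulNmx addrC.
  have lt_j1m : (j.+1 < m)%N by rewrite ltn_neqAle neq_j1m lt_jm.
  (* Here [j + 2 <= m], the range of the two-term recursion. *)
  have [q ->] : exists q, m = (j + q.+2)%N.
    by exists (m - j.+2)%N; rewrite -addSnnS -addSnnS subnKC.
  have -> : (j + q.+2 - j.+1 = q.+1)%N by rewrite -addSnnS addKn.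
  by rewrite -addnS !addKn /= !mulNmx addrC.
case: j lt_jm {R} => [|j] lt_jm /=; first by rewrite add0r.
rewrite /elim_coef ltn_eqF // mulNmx -mulmxA mulVmx // mulmx1 subSS.
by rewrite addNr.
Qed.

Lemma elim_mul_tridiag :
  \mxblock_(i < m.+1, j < m.+1) elim_block i j
    *m \mxblock_(i < m.+1, j < m.+1) ruleblock m.+1 A B C D i j =
  \mxdiag_(i < m.+1) diag_block i
    *m \mxblock_(i < m.+1, j < m.+1) lower_block i j.
Proof.
rewrite mul_mxblock mul_mxdiag_mxblock; apply: eq_mxblock => i j.
case: i => [[|i] lt_im] /=.
  rewrite sum_elim_coef_ruleblock //.
  by case: eqP => _; rewrite ?mulmx1 // raddf0 mulmx0.
rewrite mul1mx (bigD1 (Ordinal (ltnW lt_im))) //= eqxx mul1mx.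
rewrite big1 ?addr0 // => k; rewrite -val_eqE /= => /negPf->.
by rewrite raddf0 mul0mx.
Qed.

(** The pivot of block column [i] is the shifted identity in block row
    [i + 1], except in the last column, where it is the coefficient [I] that
    the first row gives to the last block row. *)
Lemma unitmx_elim :
  \mxblock_(i < m.+1, j < m.+1) elim_block i j \in unitmx.
Proof.
apply: (@unitmx_pivots _ _ _ _ (@ordS _)) => [i|i j lt_ij] /=.
  have := ltn_ord i; rewrite ltnS leq_eqVlt => /orP[/eqP->|lt_im].
    by rewrite modnn /= /elim_coef eqxx unitmx1.
  by rewrite modn_small ?ltnS //= eqxx unitmx1.
rewrite modn_small ?ltnS /=; last by rewrite (leq_trans lt_ij) // -ltnS.
by rewrite gtn_eqF // raddf0.
Qed.

Lemma unitmx_lower :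
  \mxblock_(i < m.+1, j < m.+1) lower_block i j \in unitmx.
Proof.
apply: (@unitmx_pivots _ _ _ _ id) => [[[|i] lt_im] | [[|i] lt_im] [j lt_jm]].
- by rewrite /= unitmx1.
- by rewrite /= /ruleblock eqxx ltn_eqF.
- by move=> /= /gtn_eqF->; rewrite raddf0.
move=> /= lt_ij; rewrite /ruleblock (gtn_eqF lt_ij) (ltn_eqF (ltnW lt_ij)).
by rewrite ltn_eqF // ltnW // ltnW.
Qed.

Lemma rank_tridiag :
  \rank (\mxblock_(i < m.+1, j < m.+1) ruleblock m.+1 A B C D i j) =
  (m * n + \rank (P m.+1))%N.
Proof.
have Kfull := unitmx_elim; rewrite -row_full_unit in Kfull.
have Lfree := unitmx_lower; rewrite -row_free_unit in Lfree.
rewrite -(eqmxMfull _ Kfull) elim_mul_tridiag mxrankMfree //.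
rewrite rank_mxdiag big_ord_recl /= addnC.
by under eq_bigr do rewrite mxrank1; rewrite sum_nat_const card_ord.
Qed.

End Elimination.

Theorem theorem5p3 (p m n : nat) (a b c d e f g h : 'F_p) :
  prime p -> (2 <= m)%N -> (2 <= n)%N ->
  \rank (B1mx n e f g) = n ->
  \rank (TRphi m n a b c d e f g h) =
    ((m - 1) * n
     + \rank (Pseq (A1mx n d h) (B1mx n e f g) (C1mx n a b c)
                (D1mx n a b c e f g) m))%N.
Proof.
case: m => // m _ _ _ rankB; rewrite subSS subn0; apply: rank_tridiag.
by rewrite -row_free_unit /row_free rankB.
Qed.
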